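(* Let $p,l$ be two distinct odd prime numbers. Suppose that either $p$ and $l$ are both congruent to $1$ modulo $4$, or that each of $p$ and $l$ is congruent to $1$ or $3$ modulo $8$. Then there are commuting quaternions $x\in X_p$, $y\in X_l$.
   Context: $\mathbb{H}(\mathbb{Z})$ is the ring of Hamilton quaternions $x_0+x_1i+x_2j+x_3k$ with integer coefficients ($i^2=j^2=k^2=-1$, $ij=-ji=k$), with norm $|x|^2=x_0^2+x_1^2+x_2^2+x_3^2$. For an odd prime $q$, $X_q$ is the set of $x=x_0+x_1i+x_2j+x_3k\in\mathbb{H}(\mathbb{Z})$ with $|x|^2=q$ such that: $x_0$ is odd and $x_1,x_2,x_3$ are even if $q\equiv 1\pmod 4$; $x_1$ is even and $x_0,x_2,x_3$ are odd if $q\equiv 3\pmod 4$. *)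

(* Defs.v *)
From HB Require Import structures.
From mathcomp Require Import all_boot all_order all_algebra.
From mathcomp Require Import ring.
Set Implicit Arguments.
Unset Strict Implicit.
Unset Printing Implicit Defensive.
Import GRing.Theory.
Local Open Scope ring_scope.

(* Quat x0 x1 x2 x3 stands for x0 + x1 i + x2 j + x3 k. *)
Record quat : Type :=
  Quat { qre : int; qi : int; qj : int; qk : int }.

Definition quat_to_prod (x : quat) : int * int * int * int :=
  (qre x, qi x, qj x, qk x).
Definition quat_of_prod (u : int * int * int * int) : quat :=
  let: (a, b, c, d) := u in Quat a b c d.
Lemma quat_to_prodK : cancel quat_to_prod quat_of_prod.
Proof. by case. Qed.
HB.instance Definition _ := Choice.copy quat (can_type quat_to_prodK).

Definition quat0 : quat := Quat 0 0 0 0.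
Definition quat1 : quat := Quat 1 0 0 0.
Definition quat_opp (x : quat) : quat :=
  Quat (- qre x) (- qi x) (- qj x) (- qk x).
Definition quat_add (x y : quat) : quat :=
  Quat (qre x + qre y) (qi x + qi y) (qj x + qj y) (qk x + qk y).
(* Bilinear extension of i^2 = j^2 = k^2 = -1, ij = -ji = k; see quat_mulii
   to quat_mulji and quatE below. *)
Definition quat_mul (x y : quat) : quat :=
  let: Quat x0 x1 x2 x3 := x in
  let: Quat y0 y1 y2 y3 := y in
  Quat (x0 * y0 - x1 * y1 - x2 * y2 - x3 * y3)
       (x0 * y1 + x1 * y0 + x2 * y3 - x3 * y2)
       (x0 * y2 - x1 * y3 + x2 * y0 + x3 * y1)
       (x0 * y3 + x1 * y2 - x2 * y1 + x3 * y0).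

Lemma quat_addA : associative quat_add.
Proof. by move=> [????] [????] [????]; congr Quat => /=; ring. Qed.
Lemma quat_addC : commutative quat_add.
Proof. by move=> [????] [????]; congr Quat => /=; ring. Qed.
Lemma quat_add0 : left_id quat0 quat_add.
Proof. by move=> [????]; congr Quat => /=; ring. Qed.
Lemma quat_addN : left_inverse quat0 quat_opp quat_add.
Proof. by move=> [????]; congr Quat => /=; ring. Qed.
HB.instance Definition _ :=
  GRing.isZmodule.Build quat quat_addA quat_addC quat_add0 quat_addN.

Lemma quat_mulA : associative quat_mul.
Proof. by move=> [????] [????] [????]; congr Quat => /=; ring. Qed.
Lemma quat_mul1l : left_id quat1 quat_mul.
Proof. by move=> [????]; congr Quat => /=; ring. Qed.
Lemma quat_mul1r : right_id quat1 quat_mul.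
Proof. by move=> [????]; congr Quat => /=; ring. Qed.
Lemma quat_mulDl : left_distributive quat_mul quat_add.
Proof. by move=> [????] [????] [????]; congr Quat => /=; ring. Qed.
Lemma quat_mulDr : right_distributive quat_mul quat_add.
Proof. by move=> [????] [????] [????]; congr Quat => /=; ring. Qed.
Lemma quat1_neq0 : quat1 != quat0.
Proof. by []. Qed.
HB.instance Definition _ :=
  GRing.Zmodule_isNzRing.Build quat quat_mulA quat_mul1l quat_mul1r
    quat_mulDl quat_mulDr quat1_neq0.

Definition iq : quat := Quat 0 1 0 0.
Definition jq : quat := Quat 0 0 1 0.
Definition kq : quat := Quat 0 0 0 1.

Lemma quat_mulii : iq * iq = -1. Proof. by []. Qed.
Lemma quat_muljj : jq * jq = -1. Proof. by []. Qed.
Lemma quat_mulkk : kq * kq = -1. Proof. by []. Qed.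
Lemma quat_mulij : iq * jq = kq. Proof. by []. Qed.
Lemma quat_mulji : jq * iq = - kq. Proof. by []. Qed.

Lemma quat_intr (a : int) : a%:~R = Quat a 0 0 0.
Proof.
have nat_case n : (n%:Z%:~R : quat) = Quat n%:Z 0 0 0.
  elim: n => [//|n IHn].
  by rewrite intS rmorphD /= IHn; congr Quat => /=; ring.
case: a => n; first exact: nat_case.
by rewrite NegzE rmorphN /= nat_case.
Qed.

Lemma quatE (x : quat) :
  x = (qre x)%:~R + (qi x)%:~R * iq + (qj x)%:~R * jq + (qk x)%:~R * kq.
Proof. by case: x => ????; rewrite !quat_intr; congr Quat => /=; ring. Qed.

(* This is |x|^2, not |x|. *)
Definition normq (x : quat) : int :=
  qre x ^+ 2 + qi x ^+ 2 + qj x ^+ 2 + qk x ^+ 2.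

Definition evenz (a : int) : bool := (2 %| a)%Z.
Definition oddz (a : int) : bool := ~~ evenz a.

(* Only meant for an odd prime q, where exactly one of the two congruences
   modulo 4 holds. *)
Definition Xset (q : nat) : pred quat :=
  [pred x : quat |
    [&& normq x == q%:Z,
        (q == 1 %[mod 4])%N ==>
          [&& oddz (qre x), evenz (qi x), evenz (qj x) & evenz (qk x)]
      & (q == 3 %[mod 4])%N ==>
          [&& evenz (qi x), oddz (qre x), oddz (qj x) & oddz (qk x)]]].

(* Main.v *)
(* Write p = a^2 + d b^2, with d = 1 if p = 1 mod 4 and d = 2 if p = 1, 3 mod 8,
   and likewise l with the same d.  The quaternions a + b i (for d = 1), or
   a + b (j + k) (for d = 2), have norm a^2 + d b^2, and those of the same shape
   commute because they lie in the image of Z[sqrt(-d)].  Reducing a^2 + d b^2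
   modulo 4 gives the parities that X_p requires.

   The representation comes from a square root of -d modulo p and Thue's
   pigeonhole argument.  The square root is found in the field of p^2 elements:
   if z is a primitive 8th root of unity, z^2 squares to -1 and z - z^-1 = z + z^3
   squares to -2, and when p lies in the given classes they are fixed by the Frobenius
   map, hence lie in the prime field. *)
Require Import Defs.
From mathcomp Require Import all_boot all_order all_algebra.
From mathcomp Require Import cyclic all_field zify ring.
Import GRing.Theory Num.Theory.
Local Open Scope ring_scope.

(** The |F| - 1 nonzero elements are all roots of X^(|F|-1) - 1, so one of them is a primitive root
    of that order; a suitable power of it has order m. *)
Lemma finField_has_prim_root (F : finFieldType) (m : nat) :
  (m %| #|F|.-1)%N -> exists z : F, m.-primitive_root z.
Proof.
move=> m_dv.
have F_gt1 : (1 < #|F|)%N by rewrite (cardD1 0) (cardD1 1) !inE oner_eq0.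
have /hasP[z _ z_prim] : has (#|F|.-1).-primitive_root (enum [pred x : F | x != 0]).
  apply: has_prim_root; first by rewrite -ltnS prednK // ltnW.
  - apply/allP => x; rewrite mem_enum inE => x_neq0.
    rewrite unity_rootE -(inj_eq (mulfI x_neq0)) -exprS prednK ?mulr1 ?expf_card //.
    exact: ltnW.
  - exact: enum_uniq.
  - rewrite -cardE (cardD1 0) [0 \in _]inE /=.
    by apply: subset_leq_card; apply/subsetP => x; rewrite !inE andbT.
by exists (z ^+ (#|F|.-1 %/ m)); apply: dvdn_prim_root.
Qed.

(** X^p - X has at most p roots, and the images of 0, ..., p - 1 are p distinct ones; any other
    fixed t would be one too many. *)
Lemma natr_of_Frobenius_fixed (F : fieldType) (p : nat) (pF : p \in [pchar F]) (t : F) :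
  t ^+ p = t -> exists n : nat, t = n%:R.
Proof.
move=> tp; have p_gt1 := prime_gt1 (pcharf_prime pF).
have [/mapP[n _ ->]|t_notin] := boolP (t \in [seq n%:R | n <- iota 0 p]).
  by exists n.
set rs := [seq n%:R | n <- iota 0 p] in t_notin.
have size_q : size ('X^p - 'X : {poly F}) = p.+1.
  by rewrite size_polyDl size_polyXn // size_polyN size_polyX.
have: (size (t :: rs) < size ('X^p - 'X : {poly F})%R)%N; last first.
  by rewrite size_q /= size_map size_iota ltnn.
apply: max_poly_roots.
- by rewrite -size_poly_eq0 size_q.
- apply/allP => x; rewrite inE /root !hornerE subr_eq0 => /predU1P[->|].
    by rewrite tp.
  by case/mapP=> n _ ->; rewrite -(pFrobenius_autE pF) pFrobenius_aut_nat.
- rewrite /= t_notin map_inj_in_uniq ?iota_uniq // => m n.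
  rewrite !mem_iota /= add0n => m_lt n_lt.
  wlog le_mn : m n m_lt n_lt / (m <= n)%N.
    by move=> H; case/orP: (leq_total m n) => ? E; [|symmetry]; apply: H.
  move=> E; have : (p %| n - m)%N.
    by rewrite (dvdn_pcharf pF) natrB // E subrr.
  by rewrite -eqn_mod_dvd // !modn_small // => /eqP.
Qed.

Lemma sqrt_opp_mod_prime (F : fieldType) (p d : nat) (t : F) :
  p \in [pchar F] -> t ^+ p = t -> t ^+ 2 = - d%:R ->
  exists n : nat, (p %| n ^ 2 + d)%N.
Proof.
move=> pF /(natr_of_Frobenius_fixed _ _ pF)[n ->] n2; exists n.
by rewrite (dvdn_pcharf pF) natrD natrX n2 addNr.
Qed.

(** With p = 2k + 1, p^2 - 1 = 4k(k + 1) is a multiple of 8, so the field of p^2 elements has a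
    primitive 8th root of unity; its 4th power is a square root of 1 other than 1. *)
Lemma primitive8_root_mod_prime (p : nat) :
  prime p -> odd p ->
  exists (F : fieldType) (z : F), p \in [pchar F] /\ z ^+ 4 = -1.
Proof.
move=> p_prime p_odd.
have [F pF cardF] := pPrimePowerField p_prime (isT : (0 < 2)%N).
have /(finField_has_prim_root F 8)[z z_prim] : (8 %| #|F|.-1)%N.
  rewrite cardF; apply/dvdnP.
  have [k ->] : exists k, p = (2 * k + 1)%N by exists p./2; lia.
  have [m] : exists m, (k * k.+1 = 2 * m)%N.
    by exists (k * k.+1)./2; have := oddM k k.+1; rewrite /=; lia.
  by move=> km; exists m; rewrite expnS expn1; nia.
exists F, z; split=> //.
apply/eqP; have : (z ^+ 4) ^+ 2 == 1 by rewrite -exprM (prim_expr_order z_prim).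
rewrite sqrf_eq1 => /orP[|//].
by rewrite -(prim_order_dvd z_prim).
Qed.

Lemma sqrtN1_mod_prime (p : nat) :
  prime p -> (p = 1 %[mod 4])%N -> exists n : nat, (p %| n ^ 2 + 1)%N.
Proof.
move=> p_prime p_mod.
have p_odd : odd p by lia.
have [F [z [pF z4]]] := primitive8_root_mod_prime p p_prime p_odd.
apply: (sqrt_opp_mod_prime F p 1 (z ^+ 2)) => //; last by rewrite -exprM z4.
have -> : p = (4 * (p %/ 4) + 1)%N by lia.
by rewrite exprD expr1 exprM -(exprM z 2 4) (exprM z 4 2) z4 sqrrN !expr1n mul1r.
Qed.

Lemma sqrtN2_mod_prime (p : nat) :
  prime p -> (p = 1 %[mod 8] \/ p = 3 %[mod 8])%N ->
  exists n : nat, (p %| n ^ 2 + 2)%N.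
Proof.
move=> p_prime p_mod.
have p_odd : odd p by lia.
have [F [z [pF z4]]] := primitive8_root_mod_prime p p_prime p_odd.
have z8k k : z ^+ (8 * k) = 1.
  by rewrite exprM (exprM z 4 2) z4 sqrrN !expr1n.
apply: (sqrt_opp_mod_prime F p 2 (z + z ^+ 3)) => //; last first.
  have -> : (z + z ^+ 3) ^+ 2 = z ^+ 2 + 2 * z ^+ 4 + z ^+ 4 * z ^+ 2 by ring.
  by rewrite z4; ring.
(* Frobenius maps z + z^3 to z^p + z^(3p), with exponents read modulo 8: p = 1 fixes both terms, p =
   3 swaps them because z^9 = z. *)
rewrite -(pFrobenius_autE pF) rmorphD rmorphXn /= pFrobenius_autE.
have zp : z ^+ p = z ^+ (p %% 8).
  have {1}-> : p = (8 * (p %/ 8) + p %% 8)%N by lia.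
  by rewrite exprD z8k mul1r.
rewrite zp; case: p_mod => ->; first by rewrite expr1.
rewrite -exprM addrC; congr (_ + _).
by rewrite (exprD z (8 * 1) 1) z8k mul1r.
Qed.

Lemma exists_floor_sqrt (n : nat) : exists k, (k ^ 2 <= n < k.+1 ^ 2)%N.
Proof.
elim: n => [|n [k /andP[lek ltk]]]; first by exists 0%N.
have [lt|ge] := ltnP n.+1 (k.+1 ^ 2); first by exists k; rewrite lt leqW.
by exists k.+1; rewrite ge /=; nia.
Qed.

(** Let k be the integer part of the square root of p. The (k + 1)^2 > p pairs with entries in
    [0, k] cannot all differ in x + n y modulo p. Two colliding pairs differ by at most k in each
    entry, and k^2 < p because a prime is not a square. *)
Lemma thue_mod_prime (p n : nat) :
  prime p ->
  exists a b : int, [/\ (a != 0) || (b != 0), a ^+ 2 < p%:Z, b ^+ 2 < p%:Z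
                      & (p%:Z %| a - n%:Z * b)%Z].
Proof.
move=> p_prime; have p_gt0 := prime_gt0 p_prime.
have [k /andP[lek ltk]] := exists_floor_sqrt p.
have ltk2 : (k ^ 2 < p)%N.
  rewrite ltn_neqAle lek andbT; apply/eqP => pk.
  have p_dv_k : (p %| k)%N.
    by have := Euclid_dvdX k 2 p_prime; rewrite pk dvdnn andbT => <-.
  have k_gt0 : (0 < k)%N by move: p_gt0; rewrite -pk; case: (k).
  by have := dvdn_leq k_gt0 p_dv_k; have := prime_gt1 p_prime; nia.
pose f (u : 'I_k.+1 * 'I_k.+1) := Ordinal (ltn_pmod (u.1 + n * u.2) p_gt0).
have /injectivePn[[x1 y1] [[x2 y2] neq /(congr1 val) /= eqf]] : ~~ injectiveb f.
  apply/injectiveP => /leq_card; rewrite card_prod !card_ord.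
  by rewrite leqNgt mulnn ltk.
(* The second difference is reversed: the collision reads x1 - x2 = n (y2 - y1) modulo p. *)
exists (x1%:Z - x2%:Z), (y2%:Z - y1%:Z).
have := ltn_ord x1; have := ltn_ord x2; have := ltn_ord y1; have := ltn_ord y2.
move=> ly2 ly1 lx2 lx1; split; [| nia | nia |].
  rewrite !subr_eq0 -negb_and; apply: contra neq => /andP[/eqP[ex] /eqP[ey]].
  by apply/eqP; congr (_, _); apply: val_inj.
have -> : x1%:Z - x2%:Z - n%:Z * (y2%:Z - y1%:Z)
        = (x1 + n * y1)%N%:Z - (x2 + n * y2)%N%:Z by rewrite !PoszD !PoszM; ring.
by rewrite -eqz_mod_dvd !modz_nat eqf.
Qed.

(** Thue's a and b satisfy a = n b modulo p, so p divides a^2 + d b^2; as both squares are below p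
    and not both zero, this value lies strictly between 0 and (d + 1) p. *)
Lemma small_multiple_represented (p d n : nat) :
  prime p -> (0 < d)%N -> (p %| n ^ 2 + d)%N ->
  exists (a b : int) (m : nat),
    [/\ a ^+ 2 + d%:Z * b ^+ 2 = (m * p)%N%:Z, (0 < m)%N & (m <= d)%N].
Proof.
move=> p_prime d_gt0 /dvdnP[c nd].
have [a [b [neq0 a_lt b_lt /dvdzP[e ab]]]] := thue_mod_prime p n p_prime.
exists a, b.
have [m em] : exists m : int, a ^+ 2 + d%:Z * b ^+ 2 = m * p%:Z.
  (* From a^2 + d b^2 = (a - n b)(a + n b) + (n^2 + d) b^2. *)
  exists (e * (a + n%:Z * b) + c%:Z * b ^+ 2).
  have {}nd : n%:Z ^+ 2 + d%:Z = c%:Z * p%:Z by lia.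
  by rewrite mulrDl mulrAC -ab (mulrAC c%:Z) -nd; ring.
have s_gt0 : 0 < a ^+ 2 + d%:Z * b ^+ 2.
  by case/orP: neq0 => ?; nia.
exists `|m|%N; split; nia.
Qed.

Lemma int_double_cases (a : int) : exists c : int, a = 2 * c \/ a = 2 * c + 1.
Proof. by exists (a %/ 2)%Z; lia. Qed.

Lemma evenz_double (a : int) : evenz (2 * a).
Proof. by rewrite /evenz; lia. Qed.

Lemma evenz_doubleS (a : int) : evenz (2 * a + 1) = false.
Proof. by rewrite /evenz; lia. Qed.

Lemma prime_eq_sqrD (p : nat) :
  prime p -> (p = 1 %[mod 4])%N -> exists a b : int, a ^+ 2 + b ^+ 2 = p%:Z.
Proof.
move=> p_prime /(sqrtN1_mod_prime p p_prime)[n].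
case/(small_multiple_represented p 1 n p_prime isT) => a [b [m [ab m_gt0 m_le1]]].
by exists a, b; nia.
Qed.

Lemma prime_eq_sqrD2 (p : nat) :
  prime p -> (p = 1 %[mod 8] \/ p = 3 %[mod 8])%N ->
  exists a b : int, a ^+ 2 + 2 * b ^+ 2 = p%:Z.
Proof.
move=> p_prime /(sqrtN2_mod_prime p p_prime)[n].
case/(small_multiple_represented p 2 n p_prime isT) => a [b [m [ab m_gt0 m_le2]]].
have [m1|m2] : m = 1%N \/ m = 2%N by lia.
  by exists a, b; rewrite m1 in ab; lia.
rewrite m2 in ab.
(* In a^2 + 2 b^2 = 2 p, a = 2 c is even, and halving gives b^2 + 2 c^2 = p. *)
have [c [ac|ac]] := int_double_cases a; rewrite ac in ab; last by lia.
by exists b, c; lia.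
Qed.

Lemma Xset_sqrD (p : nat) :
  prime p -> (p = 1 %[mod 4])%N -> exists a b : int, Quat a b 0 0 \in Xset p.
Proof.
move=> p_prime p_mod; have [a [b ab]] := prime_eq_sqrD p p_prime p_mod.
(* Since p is odd, exactly one of a and b is odd; it becomes the real part. *)
have [e [ea|ea]] := int_double_cases a; have [f [fb|fb]] := int_double_cases b;
  subst a b; try (by exfalso; nia);
  [exists (2 * f + 1), (2 * e) | exists (2 * e + 1), (2 * f)];
  rewrite inE /oddz /= (_ : evenz 0) // evenz_double evenz_doubleS; apply/and3P;
  by split; [apply/eqP; rewrite /Defs.normq /=; lia | lia | lia].
Qed.

Lemma Xset_sqrD2 (p : nat) :
  prime p -> (p = 1 %[mod 8] \/ p = 3 %[mod 8])%N ->
  exists a b : int, Quat a 0 b b \in Xset p.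
Proof.
move=> p_prime p_mod; have [a [b ab]] := prime_eq_sqrD2 p p_prime p_mod.
(* Here a is odd since p is; modulo 4, p is 1 for even b and 3 for odd b, as [Xset] asks of the j
   and k coordinates. *)
have [e [ea|ea]] := int_double_cases a; have [f [fb|fb]] := int_double_cases b;
  subst a b; try (by exfalso; nia);
  [exists (2 * e + 1), (2 * f) | exists (2 * e + 1), (2 * f + 1)];
  rewrite inE /oddz /= ?evenz_double ?evenz_doubleS; apply/and3P;
  by split; [apply/eqP; rewrite /Defs.normq /=; lia | lia | lia].
Qed.

Theorem proposition24 (p l : nat)
    (p_prime : prime p) (l_prime : prime l)
    (p_odd : odd p) (l_odd : odd l) (p_neq_l : p != l)
    (Hmod : (p = 1 %[mod 4] /\ l = 1 %[mod 4])%N \/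
            ((p = 1 %[mod 8] \/ p = 3 %[mod 8])%N /\
             (l = 1 %[mod 8] \/ l = 3 %[mod 8])%N)) :
  exists x y : quat, [/\ x \in Xset p, y \in Xset l & x * y = y * x].
Proof.
case: Hmod => [[/(Xset_sqrD p p_prime)[a [b pX]] /(Xset_sqrD l l_prime)[c [e lX]]]
             |[/(Xset_sqrD2 p p_prime)[a [b pX]] /(Xset_sqrD2 l l_prime)[c [e lX]]]].
- by exists (Quat a b 0 0), (Quat c e 0 0); split=> //; congr Quat => /=; ring.
- by exists (Quat a 0 b b), (Quat c 0 e e); split=> //; congr Quat => /=; ring.
Qed.
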